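(* Let $\Gamma$ be a finitely generated group and $p$ a prime number or $p=0$. There exist finitely many fields $K_\nu$ of characteristic $p$, each of finite transcendence degree over $\mathbb F_p$ (where $\mathbb F_0:=\mathbb Q$), and characters $\xi_\nu:\Gamma\to K_\nu^*$ such that: (1) $H^1(\Gamma,\xi_\nu)\ne 0$ for every $\nu$, i.e. $\xi_\nu\in E^1(\Gamma,K_\nu)$; (2) for every field $K$ of characteristic $p$ and every $\chi\in E^1(\Gamma,K)$ there is an index $\nu$ with $\ker\chi\supset\ker\xi_\nu$.
   Context: For a character $\chi:\Gamma\to K^*$, $H^1(\Gamma,\chi)$ is the first cohomology of $\Gamma$ with coefficients in $K$ twisted by $\chi$ (cocycles $\theta(gh)=\theta(g)+\chi(g)\theta(h)$ modulo coboundaries $g\mapsto\mu(\chi(g)-1)$), and $E^1(\Gamma,K)=\{\chi: H^1(\Gamma,\chi)\ne0\}$. *)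

(* Defs.v *)
From Stdlib Require List.
From HB Require Import structures.
From mathcomp Require Import all_boot all_order all_algebra.
Set Implicit Arguments. Unset Strict Implicit. Unset Printing Implicit Defensive.
Import GRing.Theory.
Local Open Scope ring_scope.

Record group := Group {
  gcar :> Type;
  gmul : gcar -> gcar -> gcar;
  gone : gcar;
  ginv : gcar -> gcar;
  gmulA : forall x y z, gmul x (gmul y z) = gmul (gmul x y) z;
  gmul1 : forall x, gmul gone x = x;
  gmulV : forall x, gmul (ginv x) x = gone }.

Inductive generated (G : group) (S : list G) : G -> Prop :=
| gen_in x : List.In x S -> generated S x
| gen_one : generated S (gone G)
| gen_mul x y : generated S x -> generated S y -> generated S (gmul x y)
| gen_inv x : generated S x -> generated S (ginv x).

Definition finitely_generated (G : group) : Prop :=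
  exists S : list G, forall g : G, generated S g.

Definition is_character (G : group) (K : fieldType) (chi : G -> K) : Prop :=
  (forall g, chi g != 0) /\ (forall g h, chi (gmul g h) = chi g * chi h).

Definition cocycle (G : group) (K : fieldType) (chi theta : G -> K) : Prop :=
  forall g h, theta (gmul g h) = theta g + chi g * theta h.

Definition coboundary (G : group) (K : fieldType) (chi theta : G -> K) : Prop :=
  exists mu : K, forall g, theta g = mu * (chi g - 1).

Definition H1_nonzero (G : group) (K : fieldType) (chi : G -> K) : Prop :=
  exists theta : G -> K, cocycle chi theta /\ ~ coboundary chi theta.

Definition in_E1 (G : group) (K : fieldType) (chi : G -> K) : Prop :=
  is_character chi /\ H1_nonzero chi.

Definition has_char (K : fieldType) (p : nat) : Prop :=
  if p == 0%N then [pchar K] =i pred0 else p \in [pchar K].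

Inductive in_subring (K : fieldType) (xs : list K) : K -> Prop :=
| sr_one : in_subring xs 1
| sr_gen x : List.In x xs -> in_subring xs x
| sr_add x y : in_subring xs x -> in_subring xs y -> in_subring xs (x + y)
| sr_opp x : in_subring xs x -> in_subring xs (- x)
| sr_mul x y : in_subring xs x -> in_subring xs y -> in_subring xs (x * y).

(* y is algebraic over the subfield F_p(xs) (denominators cleared). *)
Definition algebraic_over (K : fieldType) (xs : list K) (y : K) : Prop :=
  exists q : {poly K}, q != 0 /\ (forall i, in_subring xs q`_i) /\ root q y.

Definition finite_trdeg (K : fieldType) : Prop :=
  exists xs : list K, forall y : K, algebraic_over xs y.

(* Main.v *)
(* The kernels of the characters in E^1 are well-behaved in two ways. First, each is
   generated modulo [G, G] by finitely many elements, because subgroups of Z^n are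
   finitely generated. Second, E^1 is stable under ultraproducts: since cocycles are
   determined by their values on finitely many generators, an ultraproduct of cocycles
   that are not coboundaries is not a coboundary. If no finite family of such kernels
   sufficed, one could list the countably many finite subsets D_j of G that generate
   such a kernel and choose chi_k in E^1 containing none of D_j, j < k, in its kernel;
   a nonprincipal ultraproduct chi of the chi_k is in E^1, its kernel is generated by
   some D_j, hence chi_k kills D_j for arbitrarily large k, a contradiction. *)
Require Import Defs.
From HB Require Import structures.
From mathcomp Require Import all_boot all_order all_algebra.
From mathcomp Require Import boolp classical_sets filter.
Set Implicit Arguments.
Unset Strict Implicit.
Unset Printing Implicit Defensive.
Import Order.TTheory GRing.Theory Num.Theory.
Local Open Scope ring_scope.

(** * Subgroups of Z^n *)

Definition subgroup (V : zmodType) (N : V -> Prop) : Prop :=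
  N 0 /\ forall u v, N u -> N v -> N (u - v).

Lemma subgroupN (V : zmodType) (N : V -> Prop) (u : V) :
  subgroup N -> N u -> N (- u).
Proof. by move=> [N0 NB] Nu; rewrite -sub0r; apply: NB. Qed.

Lemma subgroupD (V : zmodType) (N : V -> Prop) (u v : V) :
  subgroup N -> N u -> N v -> N (u + v).
Proof.
move=> sN Nu Nv; rewrite -[v]opprK; have [_] := sN; apply=> //.
exact: subgroupN.
Qed.

Lemma subgroupMz (V : zmodType) (N : V -> Prop) (u : V) (m : int) :
  subgroup N -> N u -> N (u *~ m).
Proof.
move=> sN Nu.
have Nn k : N (u *+ k).
  by elim: k => [|k IH]; [have [] := sN | rewrite mulrS; apply: subgroupD].
case: m => k; first exact: Nn.
by rewrite NegzE mulrNz; apply: subgroupN => //; apply: Nn.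
Qed.

(** A staircase basis is built one coordinate at a time. Generation is phrased through an arbitrary
    subgroup [M], so that it can later be tested on the vectors killed by another character without
    writing integer combinations. *)
Lemma int_subgroup_fg n (N : 'rV[int]_n -> Prop) : subgroup N ->
  exists L : seq 'rV[int]_n, (forall e, e \in L -> N e) /\
    forall M, subgroup M -> (forall e, e \in L -> M e) -> forall e, N e -> M e.
Proof.
(* The induction is on [k], beyond which all coordinates of elements of [N] vanish. *)
suff H k : forall N : 'rV[int]_n -> Prop, subgroup N ->
    (forall e (i : 'I_n), N e -> (k <= i)%N -> e 0 i = 0) ->
  exists L : seq 'rV[int]_n, (forall e, e \in L -> N e) /\
    forall M, subgroup M -> (forall e, e \in L -> M e) -> forall e, N e -> M e.
  by move=> sN; apply: (H n) => // e i _; rewrite leqNgt ltn_ord.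
elim: k => [|k IH] {}N sN Nz.
  exists [::]; split=> // M [M0 _] _ e Ne.
  by suff -> : e = 0 by []; apply/rowP => i; rewrite mxE Nz.
case: (pselect (exists2 j : 'I_n, j = k :> nat & exists2 e, N e & e 0 j != 0));
  last first.
  move=> Nk; apply: IH => // e i Ne; rewrite leq_eqVlt => /orP[/eqP ki|]; last exact: Nz.
  by apply/eqP/negPn/negP => ei; apply: Nk; exists i => //; exists e.
case=> j jk [e0 Ne0 e0j].
have [N0 NB] := sN.
(* The shift [d.+1] makes the minimum range over positive values: [f] attains the least positive
   [j]-th coordinate in [N]. *)
pose P d := `[< exists2 e, N e & e 0 j = d.+1%:Z >].
have exP : exists d, P d.
  exists (absz (e0 0 j)).-1; apply/asboolP; rewrite prednK ?absz_gt0 //.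
  case: (lerP 0 (e0 0 j)) => s.
    by exists e0 => //; rewrite gez0_abs.
  exists (- e0); first exact: subgroupN.
  by rewrite mxE ltz0_abs.
case: (ex_minnP exP) => d /asboolP[f Nf fj] dmin.
pose N' e := N e /\ e 0 j = 0.
case: (IH N').
- split; first by split=> //; rewrite mxE.
  move=> u v [Nu uj] [Nv vj]; split; first exact: NB.
  by rewrite !mxE uj vj subrr.
- move=> e i [Ne ej]; rewrite leq_eqVlt => /orP[/eqP ki|]; last exact: Nz.
  by have -> : i = j by apply: val_inj; rewrite /= -ki jk.
move=> L [LN LM]; exists (f :: L); split.
  by move=> e; rewrite inE => /predU1P[->|/LN[]].
move=> M sM ML e Ne.
have Mf : M f by apply: ML; rewrite mem_head.
(* Euclidean division: subtracting [f *~ q] leaves the remainder as [j]-th coordinate. A nonzero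
   remainder would contradict the minimality of [d], so the difference lies in [N']. *)
pose q := divz (e 0 j) d.+1%:Z.
have Ne' : N (e - f *~ q) by apply: NB => //; apply: subgroupMz.
have ej : (e - f *~ q) 0 j = modz (e 0 j) d.+1%:Z.
  have -> : (e - f *~ q) 0 j = e 0 j - f 0 j *~ q.
    by rewrite -scaler_int !mxE mulrzl.
  by rewrite fj /modz -mulrzr intz mulrC.
have Me' : M (e - f *~ q).
  apply: LM => //; first by move=> g gL; apply: ML; rewrite inE gL orbT.
  split=> //; rewrite ej; apply/eqP/negPn/negP => r0.
  have rge : (0 <= modz (e 0 j) d.+1%:Z) by rewrite modz_ge0.
  have rlt : (modz (e 0 j) d.+1%:Z < d.+1%:Z) by rewrite ltz_pmod.
  move: ej rge rlt r0; case: (modz (e 0 j) d.+1%:Z) => // -[//|r] ej _ rlt _.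
  have /dmin : P r by apply/asboolP; exists (e - f *~ q).
  by rewrite leqNgt -ltnS; move: rlt; rewrite ltz_nat ltnS => ->.
rewrite -[e](subrK (f *~ q)); apply: subgroupD => //; exact: subgroupMz.
Qed.

(** * Finite generation of kernels of characters *)

Lemma In_nth_ord (T : Type) (x0 x : T) (S : seq T) :
  List.In x S -> exists i : 'I_(size S), nth x0 S i = x.
Proof.
elim: S => [//|y S IH] /= [-> | /IH[i <-]]; first by exists ord0.
by exists (lift ord0 i).
Qed.

Lemma character1 (G : group) (K : fieldType) (chi : G -> K) :
  is_character chi -> chi (gone G) = 1.
Proof.
move=> [chi0 chiM]; apply: (mulfI (chi0 (gone G))).
by rewrite -chiM gmul1 mulr1.
Qed.

Lemma characterV (G : group) (K : fieldType) (chi : G -> K) g :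
  is_character chi -> chi (ginv g) = (chi g)^-1.
Proof.
move=> chiP; have [chi0 chiM] := chiP; apply: (mulIf (chi0 g)).
by rewrite -chiM gmulV character1 // mulVf.
Qed.

(* The exponent vector of g on S, seen through characters only: the abelianization
   of G never has to be formed. *)
Definition exponent (G : group) (S : seq G) (g : G) (e : 'rV[int]_(size S)) :=
  forall (K : fieldType) (chi : G -> K), is_character chi ->
    chi g = \prod_(i < size S) chi (nth (gone G) S i) ^ e 0 i.

Lemma exponentB (G : group) (S : seq G) (g h : G) e f :
  @exponent G S g e -> exponent h f -> exponent (gmul g (ginv h)) (e - f).
Proof.
move=> ge hf K chi chiP; have [chi0 chiM] := chiP.
rewrite chiM characterV // (ge _ _ chiP) (hf _ _ chiP) -prodf_div.
by apply: eq_bigr => i _; rewrite !mxE expfzDr // invr_expz.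
Qed.

Lemma exponent1 (G : group) (S : seq G) : @exponent G S (gone G) 0.
Proof.
by move=> K chi chiP; rewrite character1 // big1 // => i _; rewrite mxE.
Qed.

Lemma exponent_exists (G : group) (S : seq G) (g : G) :
  generated S g -> exists e, @exponent G S g e.
Proof.
elim=> {g} [g /(In_nth_ord (gone G))[i <-]||g h _ [e ge] _ [f hf]|g _ [e ge]].
- exists (delta_mx 0 i) => K chi _; rewrite (bigD1 i) //= big1.
    by rewrite mxE !eqxx mulr1.
  by move=> j /negPf ji; rewrite mxE ji andbF.
- by exists 0; apply: exponent1.
- exists (e + f) => K chi chiP; have [chi0 chiM] := chiP.
  rewrite chiM (ge _ _ chiP) (hf _ _ chiP) -big_split.
  by apply: eq_bigr => i _; rewrite !mxE expfzDr.
- exists (- e) => K chi chiP; have [chi0 _] := chiP.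
  rewrite characterV // (ge _ _ chiP) -prodfV.
  by apply: eq_bigr => i _; rewrite !mxE invr_expz.
Qed.

(** The exponent vectors of elements of the kernel form a subgroup of Z^n; finitely many vectors
    generate it, and each lifts to an element of the kernel. *)
Lemma ker_character_fg (G : group) (K : fieldType) (chi : G -> K) :
  finitely_generated G -> is_character chi ->
  exists L : seq G, (forall g, List.In g L -> chi g = 1) /\
    forall (K' : fieldType) (chi' : G -> K'), is_character chi' ->
      (forall g, List.In g L -> chi' g = 1) ->
    forall g, chi g = 1 -> chi' g = 1.
Proof.
move=> [S genS] chiP; have [chi0 chiM] := chiP.
pose N e := exists2 g, @exponent G S g e & chi g = 1.
have [|L [LN NL]] := @int_subgroup_fg _ N.
  split; first by exists (gone G); [apply: exponent1 | apply: character1].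
  move=> e f [g ge g1] [h hf h1]; exists (gmul g (ginv h)).
    exact: exponentB.
  by rewrite chiM characterV // g1 h1 divr1.
have [LG [LG1 LGL]] : exists LG : seq G, (forall g, List.In g LG -> chi g = 1) /\
    forall e, e \in L -> exists2 g, List.In g LG & exponent g e.
  elim: {NL} L LN => [|e L IH] LN; first by exists [::].
  have [|LG [LG1 LGL]] := IH; first by move=> f fL; apply: LN; rewrite inE fL orbT.
  have [g ge g1] := LN e (mem_head _ _).
  exists (g :: LG); split; first by move=> h /= [<-|/LG1].
  move=> f; rewrite inE => /predU1P[->|/LGL[h]]; first by exists g => //; left.
  by exists h => //; right.
exists LG; split=> // K' chi' chi'P chi'1 g g1.
have [e ge] := exponent_exists (genS g); rewrite (ge _ _ chi'P).
(* The vectors on which [chi'] becomes trivial form a subgroup containing the generators of [N],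
   hence all of [N]. *)
pose M (e : 'rV_(size S)) := \prod_(i < size S) chi' (nth (gone G) S i) ^ e 0 i = 1.
apply: (NL M); last by exists g.
  split; first by rewrite /M big1 // => i _; rewrite mxE.
  move=> u v Mu Mv; transitivity (1 / 1 : K'); last exact: divr1.
  rewrite -[X in X / _]Mu -[X in _ / X]Mv -prodf_div.
  by apply: eq_bigr => i _; rewrite !mxE expfzDr ?invr_expz //; have [] := chi'P.
by move=> f /LGL[h hLG /(_ _ _ chi'P) hf]; rewrite /M -hf chi'1.
Qed.

(** * Finitely generated subfields *)

Lemma in_subring0 (K : fieldType) (xs : seq K) : in_subring xs 0.
Proof. by rewrite -(subrr 1); do !constructor. Qed.

Section GeneratedSubfield.
Variables (K : fieldType) (xs : seq K).

Definition gen_subfield : {pred K} :=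
  fun y => `[< exists a b,
    [/\ in_subring xs a, in_subring xs b, b != 0 & y = a / b] >].

Lemma gen_subfieldP y :
  reflect (exists a b, [/\ in_subring xs a, in_subring xs b, b != 0 & y = a / b])
          (y \in gen_subfield).
Proof. exact: asboolP. Qed.

Lemma gen_subfield_closed : divring_closed gen_subfield.
Proof.
split.
- apply/gen_subfieldP; exists 1, 1; rewrite divr1 oner_eq0.
  by split=> //; constructor.
- move=> _ _ /gen_subfieldP[a [b [sa sb b0 ->]]] /gen_subfieldP[c [d [sc sd d0 ->]]].
  apply/gen_subfieldP; exists (a * d - c * b), (b * d); split.
  + by apply: sr_add; [apply: sr_mul|apply/sr_opp/sr_mul].
  + exact: sr_mul.
  + by rewrite mulf_neq0.
  + by rewrite -mulNr addf_div // mulNr.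
- move=> _ _ /gen_subfieldP[a [b [sa sb b0 ->]]] /gen_subfieldP[c [d [sc sd d0 ->]]].
  apply/gen_subfieldP; have [->|c0] := eqVneq c 0.
    exists 0, 1; rewrite !mul0r invr0 mulr0 oner_eq0; split=> //; last by constructor.
    exact: in_subring0.
  exists (a * d), (b * c); split; [exact: sr_mul|exact: sr_mul|by rewrite mulf_neq0|].
  by rewrite invf_div mulf_div.
Qed.

HB.instance Definition _ :=
  GRing.isDivringClosed.Build K gen_subfield gen_subfield_closed.

Record subfield := Subfield { subfield_val :> K; _ : subfield_val \in gen_subfield }.

HB.instance Definition _ := [isSub for subfield_val].
HB.instance Definition _ := [Choice of subfield by <:].
HB.instance Definition _ := [SubChoice_isSubComUnitRing of subfield by <:].
HB.instance Definition _ := [SubComUnitRing_isSubIntegralDomain of subfield by <:].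
HB.instance Definition _ := [SubIntegralDomain_isSubField of subfield by <:].

Lemma gen_subfield_gen x : List.In x xs -> x \in gen_subfield.
Proof.
move=> xxs; apply/gen_subfieldP; exists x, 1.
by rewrite divr1 oner_eq0; split=> //; constructor.
Qed.

Lemma subfield_lift_gens :
  exists ys : seq subfield, map subfield_val ys = xs.
Proof.
suff H s : (forall x, List.In x s -> List.In x xs) ->
    exists ys : seq subfield, map subfield_val ys = s by exact: H.
elim: s => [|x s IH] sxs; first by exists [::].
have [|ys <-] := IH; first by move=> y ys; apply: sxs; right.
have xF : x \in gen_subfield by apply/gen_subfield_gen/sxs; left.
by exists (Subfield xF :: ys).
Qed.

(** Algebraicity over [ys] asks for coefficients in a subring of the subfield itself, so membership
    in the subring of [K] has to be transported. *)
Lemma subfield_lift_subring (ys : seq subfield) a :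
  map subfield_val ys = xs -> in_subring xs a ->
  exists2 a' : subfield, val a' = a & in_subring ys a'.
Proof.
move=> <-; elim=> {a} [|x|x y _ [x' <- ?] _ [y' <- ?]|x _ [x' <- ?]
                     |x y _ [x' <- ?] _ [y' <- ?]].
- by exists 1; [rewrite rmorph1|constructor].
- move=> /List.in_map_iff[x' [<- x'ys]]; exists x' => //; exact: sr_gen.
- by exists (x' + y'); [rewrite rmorphD|apply: sr_add].
- by exists (- x'); [rewrite rmorphN|apply: sr_opp].
- by exists (x' * y'); [rewrite rmorphM|apply: sr_mul].
Qed.

(** A fraction a / b is a root of the linear polynomial b X - a, so the lifted generators
    suffice. *)
Lemma subfield_finite_trdeg : finite_trdeg subfield.
Proof.
have [ys ysE] := subfield_lift_gens; exists ys => y.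
have /gen_subfieldP[a [b [sa sb b0 yE]]] : val y \in gen_subfield by exact: valP.
have [a' a'E sa'] := subfield_lift_subring ysE sa.
have [b' b'E sb'] := subfield_lift_subring ysE sb.
have b'0 : b' != 0 by rewrite -(inj_eq val_inj) b'E rmorph0.
exists (b' *: 'X - a'%:P); split; [|split].
- apply/eqP => /(congr1 (fun q : {poly _} => q`_1)) /eqP.
  by rewrite coefB coefZ coefX coefC subr0 mulr1 coef0 (negPf b'0).
- have s0 := in_subring0 ys; move=> i; rewrite coefB coefZ coefX coefC; apply: sr_add.
    by case: eqP; rewrite ?mulr1 ?mulr0.
  by apply: sr_opp; case: ifP.
- rewrite /root hornerD hornerN hornerZ hornerX hornerC subr_eq0.
  apply/eqP/val_inj; rewrite rmorphM /=.
  by move: yE a'E b'E => /= -> -> ->; rewrite mulrC divfK.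
Qed.

End GeneratedSubfield.

(** * Cocycles and descent to a finitely generated field *)

Lemma has_char_morph (K L : fieldType) (f : {rmorphism K -> L}) p :
  has_char L p -> has_char K p.
Proof.
rewrite /has_char; case: ifP => _; last by rewrite (fmorph_pchar f).
by move=> L0 q; rewrite -(L0 q) (fmorph_pchar f).
Qed.

Lemma cocycle1 (G : group) (K : fieldType) (chi theta : G -> K) :
  is_character chi -> cocycle chi theta -> theta (gone G) = 0.
Proof.
move=> chiP thetaP; have := thetaP (gone G) (gone G).
rewrite gmul1 (character1 chiP) mul1r => /eqP.
by rewrite -subr_eq0 opprD addrA subrr sub0r oppr_eq0 => /eqP.
Qed.

Lemma cocycleV (G : group) (K : fieldType) (chi theta : G -> K) g :
  is_character chi -> cocycle chi theta ->
  theta (ginv g) = - (chi g)^-1 * theta g.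
Proof.
move=> chiP thetaP; have := thetaP (ginv g) g.
rewrite gmulV (cocycle1 chiP thetaP) (characterV g chiP) => /eqP.
by rewrite eq_sym addr_eq0 mulNr => /eqP.
Qed.

(** Both sides are cocycles, so the set where they agree is closed under products and inverses. For
    a given [mu], being its coboundary thus amounts to finitely many equations, which is what an
    ultraproduct can control. *)
Lemma cocycle_coboundary_gen (G : group) (K : fieldType) (chi theta : G -> K)
    (S : seq G) (mu : K) :
  is_character chi -> cocycle chi theta -> (forall g, generated S g) ->
  (forall g, List.In g S -> theta g = mu * (chi g - 1)) ->
  forall g, theta g = mu * (chi g - 1).
Proof.
move=> chiP thetaP genS thetaS g; have [chi0 chiM] := chiP.
elim: (genS g) => {g} [g /thetaS //||g h _ tg _ th|g _ tg].
- by rewrite (cocycle1 chiP thetaP) (character1 chiP) subrr mulr0.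
- rewrite thetaP chiM tg th mulrCA -mulrDr; congr (_ * _).
  by rewrite mulrBr mulr1 addrC addrA subrK.
- rewrite (cocycleV g chiP thetaP) (characterV g chiP) tg mulrCA mulNr mulrBr.
  by rewrite mulVf // mulr1 opprB.
Qed.

(* The subfield is generated by the values on S of chi and of a cocycle that is not
   a coboundary: with its values kept, the cocycle needs no descent. *)
Lemma in_E1_finite_trdeg (G : group) (K : fieldType) (chi : G -> K) p :
  finitely_generated G -> has_char K p -> in_E1 chi ->
  exists (K' : fieldType) (chi' : G -> K'),
    [/\ has_char K' p, finite_trdeg K', in_E1 chi'
      & forall g, chi' g = 1 <-> chi g = 1].
Proof.
move=> [S genS] Kp [chiP [theta [thetaP theta_ncob]]].
have [chi0 chiM] := chiP.
pose xs := map chi S ++ map theta S.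
(* The two memberships are proved together because the value of [theta] at a product involves
   [chi]. *)
have FP g : chi g \in gen_subfield xs /\ theta g \in gen_subfield xs.
  elim: (genS g) => {g} [g gS||g h _ [cg tg] _ [ch th]|g _ [cg tg]].
  - split; apply: gen_subfield_gen; apply/List.in_app_iff.
      by left; apply: List.in_map.
    by right; apply: List.in_map.
  - by rewrite (character1 chiP) (cocycle1 chiP thetaP) rpred0 rpred1.
  - by rewrite chiM thetaP rpredD ?rpredM.
  - by rewrite (characterV g chiP) (cocycleV g chiP thetaP) mulNr rpredN rpredM ?rpredV.
pose chi' g : subfield xs := Subfield (FP g).1.
pose theta' g : subfield xs := Subfield (FP g).2.
exists (subfield xs), chi'; split.
- exact: (has_char_morph (val : {rmorphism subfield xs -> K})).
- exact: subfield_finite_trdeg.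
- split; first split.
  + by move=> g; rewrite -(inj_eq val_inj) rmorph0 chi0.
  + by move=> g h; apply: val_inj; rewrite rmorphM /= chiM.
  exists theta'; split.
    by move=> g h; apply: val_inj; rewrite rmorphD rmorphM /= thetaP.
  move=> [mu muP]; apply: theta_ncob; exists (val mu) => g.
  by have /(congr1 val) := muP g; rewrite rmorphM rmorphB rmorph1.
- move=> g; split=> [/(congr1 val)|cg]; first by rewrite rmorph1.
  by apply: val_inj; rewrite rmorph1.
Qed.

(** * Ultraproducts of fields *)

Section Ultraproduct.
Local Open Scope classical_set_scope.
Local Open Scope quotient_scope.
Variable K : nat -> fieldType.

Definition seq_ring : Type := forall i, K i.

HB.instance Definition _ := gen_eqMixin seq_ring.
HB.instance Definition _ := gen_choiceMixin seq_ring.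

Implicit Types f g h : seq_ring.

Definition seq_ring_zero : seq_ring := fun=> 0.
Definition seq_ring_one : seq_ring := fun=> 1.
Definition seq_ring_opp f : seq_ring := fun i => - f i.
Definition seq_ring_add f g : seq_ring := fun i => f i + g i.
Definition seq_ring_mul f g : seq_ring := fun i => f i * g i.

Fact seq_ring_addA : associative seq_ring_add.
Proof. by move=> f g h; apply: functional_extensionality_dep => i; apply: addrA. Qed.

Fact seq_ring_addC : commutative seq_ring_add.
Proof. by move=> f g; apply: functional_extensionality_dep => i; apply: addrC. Qed.

Fact seq_ring_add0 : left_id seq_ring_zero seq_ring_add.
Proof. by move=> f; apply: functional_extensionality_dep => i; apply: add0r. Qed.

Fact seq_ring_addN : left_inverse seq_ring_zero seq_ring_opp seq_ring_add.
Proof. by move=> f; apply: functional_extensionality_dep => i; apply: addNr. Qed.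

HB.instance Definition _ := GRing.isZmodule.Build seq_ring
  seq_ring_addA seq_ring_addC seq_ring_add0 seq_ring_addN.

Fact seq_ring_mulA : associative seq_ring_mul.
Proof. by move=> f g h; apply: functional_extensionality_dep => i; apply: mulrA. Qed.

Fact seq_ring_mulC : commutative seq_ring_mul.
Proof. by move=> f g; apply: functional_extensionality_dep => i; apply: mulrC. Qed.

Fact seq_ring_mul1 : left_id seq_ring_one seq_ring_mul.
Proof. by move=> f; apply: functional_extensionality_dep => i; apply: mul1r. Qed.

Fact seq_ring_mulD : left_distributive seq_ring_mul seq_ring_add.
Proof. by move=> f g h; apply: functional_extensionality_dep => i; apply: mulrDl. Qed.

Fact seq_ring_one_neq0 : seq_ring_one != 0.
Proof.
apply/eqP => /(congr1 (fun f : seq_ring => f 0%N)) /eqP.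
by rewrite (negPf (oner_neq0 _)).
Qed.

HB.instance Definition _ := GRing.Zmodule_isComNzRing.Build seq_ring
  seq_ring_mulA seq_ring_mulC seq_ring_mul1 seq_ring_mulD seq_ring_one_neq0.

Variables (U : set_system nat) (UF : UltraFilter U).

(* The unused argument keeps the ultrafilter recoverable from the head constant,
   so that the instances below, which need it, can be inferred. *)
Definition null_ideal (_ : UltraFilter U) : {pred seq_ring} :=
  fun f => `[< U [set i | f i = 0] >].

Lemma null_ideal_closed : idealr_closed (null_ideal UF).
Proof.
split.
- by apply/asboolP; apply: filterS filterT => i.
- apply/asboolP => /filter_ex[i /eqP]; by rewrite oner_eq0.
- move=> a f g /asboolP Uf /asboolP Ug; apply/asboolP.
  apply: filterS (filterI Uf Ug) => i [/= fi gi].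
  by rewrite -[LHS]/(a i * f i + g i) fi gi mulr0 addr0.
Qed.

HB.instance Definition _ := isIdealr.Build seq_ring (null_ideal UF) null_ideal_closed.

Definition ultraproduct := {ideal_quot (null_ideal UF)}.

HB.instance Definition _ := GRing.ComNzRing.on ultraproduct.

Definition ultra_class f : ultraproduct :=
  \pi_{ideal_quot (null_ideal UF)} f.

(** Łoś's theorem for equations; with [ultra_class_neq] it carries the later transfers between the
    factors and the ultraproduct. *)
Lemma ultra_class_eq f g :
  ultra_class f = ultra_class g <-> U [set i | f i = g i].
Proof.
have -> : [set i | f i = g i] = [set i | f i - g i = 0].
  apply/funext => i; apply/propext => /=.
  by split=> [->|/eqP]; [apply: subrr | rewrite subr_eq0 => /eqP].
have := Quotient.idealrBE (null_ideal UF) f g.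
rewrite /ultra_class => E; split=> [fg|Ufg].
  have /asboolP : f - g \in null_ideal UF by rewrite E; apply/eqP.
  by [].
by apply/eqP; rewrite -E; apply/asboolP.
Qed.

Lemma ultra_class_surj x : exists f, x = ultra_class f.
Proof. by exists (repr x); rewrite /ultra_class reprK. Qed.

Lemma ultra_classD f g :
  ultra_class (fun i => f i + g i) = ultra_class f + ultra_class g.
Proof. exact: (rmorphD (\pi_{ideal_quot (null_ideal UF)})). Qed.

Lemma ultra_classB f g :
  ultra_class (fun i => f i - g i) = ultra_class f - ultra_class g.
Proof. exact: (rmorphB (\pi_{ideal_quot (null_ideal UF)})). Qed.

Lemma ultra_classM f g :
  ultra_class (fun i => f i * g i) = ultra_class f * ultra_class g.
Proof. exact: (rmorphM (\pi_{ideal_quot (null_ideal UF)})). Qed.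

Lemma ultra_class0 : ultra_class (fun=> 0) = 0.
Proof. exact: (rmorph0 (\pi_{ideal_quot (null_ideal UF)})). Qed.

Lemma ultra_class1 : ultra_class (fun=> 1) = 1.
Proof. exact: (rmorph1 (\pi_{ideal_quot (null_ideal UF)})). Qed.

(** Maximality of [U] enters here: either the set where [f] and [g] agree or its complement belongs
    to [U]. Conversely, two members of [U] always meet. *)
Lemma ultra_class_neq f g :
  ultra_class f != ultra_class g <-> U [set i | f i != g i].
Proof.
split=> [/eqP fg|Ufg]; last first.
  apply/eqP => /ultra_class_eq Efg.
  by have [i [/= + fgi]] := filter_ex (filterI Ufg Efg); rewrite fgi eqxx.
have [Efg|] := in_ultra_setVsetC [set i | f i = g i] UF.
  by case: fg; apply/ultra_class_eq.
by apply: filterS => i /eqP.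
Qed.

(** The convention that 0 has inverse 0 in each factor allows inverting any representative
    pointwise, even one with zero entries. *)
Definition ultra_inv (x : ultraproduct) : ultraproduct :=
  ultra_class (fun i => (repr x i)^-1).

Lemma ultra_mulVf x : x != 0 -> ultra_inv x * x = 1.
Proof.
rewrite -{1 3}[x]reprK -/(ultra_class _) -ultra_class0 => /ultra_class_neq x0.
rewrite -ultra_classM -ultra_class1; apply/ultra_class_eq.
by apply: filterS x0 => i /= x0; rewrite mulVf.
Qed.

Lemma ultra_inv0 : ultra_inv 0 = 0.
Proof.
have : ultra_class (repr (0 : ultraproduct)) = ultra_class (fun=> 0).
  by rewrite ultra_class0 /ultra_class reprK.
move=> /ultra_class_eq r0; rewrite -[RHS]ultra_class0; apply/ultra_class_eq.
by apply: filterS r0 => i /= ->; rewrite invr0.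
Qed.

HB.instance Definition _ :=
  GRing.ComNzRing_isField.Build ultraproduct ultra_mulVf ultra_inv0.

Lemma ultra_class_nat n : ultra_class (fun=> n%:R) = n%:R.
Proof.
elim: n => [|n IH]; first exact: ultra_class0.
rewrite mulrS -IH -ultra_class1 -ultra_classD.
apply/ultra_class_eq; apply: filterS filterT => i _ /=.
by rewrite mulrS.
Qed.

(** The characteristic is fixed by the equation p = 0, or for p = 0 by the inequations q != 0 for
    all primes q, and each of these holds in every factor. *)
Lemma ultraproduct_has_char p : (forall i, has_char (K i) p) -> has_char ultraproduct p.
Proof.
rewrite /has_char; case: ifP => _ Kp; last first.
  have /andP[p_pr _] := Kp 0%N; apply/andP; split=> //.
  rewrite -ultra_class_nat -ultra_class0; apply/eqP/ultra_class_eq.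
  by apply: filterS filterT => i _ /=; apply/eqP; have /andP[] := Kp i.
move=> q; apply/negP => /andP[q_pr]; apply/negP.
rewrite -ultra_class_nat -ultra_class0; apply/ultra_class_neq.
apply: filterS filterT => i _ /=; apply/negP => q0.
by have := Kp i q; rewrite !inE q_pr q0.
Qed.

Lemma ultraproduct_in_E1 (G : group) (chi : forall i, G -> K i) :
  finitely_generated G -> (forall i, in_E1 (chi i)) ->
  in_E1 (fun g : G => ultra_class (fun i => chi i g)).
Proof.
move=> [S genS] E1; have theta_ i := cid (E1 i).2.
pose theta i := sval (theta_ i).
have thetaP i : cocycle (chi i) (theta i) by exact: (svalP (theta_ i)).1.
have theta_ncob i : ~ coboundary (chi i) (theta i) by exact: (svalP (theta_ i)).2.
have chiP i : is_character (chi i) by exact: (E1 i).1.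
split; first split.
- move=> g; rewrite -ultra_class0; apply/ultra_class_neq.
  by apply: filterS filterT => i _ /=; apply: (chiP i).1.
- move=> g h; rewrite -ultra_classM; apply/ultra_class_eq.
  by apply: filterS filterT => i _ /=; apply: (chiP i).2.
exists (fun g : G => ultra_class (fun i => theta i g)); split.
  move=> g h; rewrite -ultra_classM -ultra_classD; apply/ultra_class_eq.
  by apply: filterS filterT => i _ /=; apply: thetaP.
move=> [mu' muP]; have [mu muE] := ultra_class_surj mu'.
have {}muP (g : G) : U [set i | theta i g = mu i * (chi i g - 1)].
  have := muP g; rewrite muE -ultra_class1 -ultra_classB -ultra_classM.
  by move/ultra_class_eq.
(* A finite intersection of members of [U] stays in [U]; applied to the generators, it makes some
   [theta i] a coboundary. *)
have muS s : U [set i | forall g : G, List.In g s -> theta i g = mu i * (chi i g - 1)].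
  elim: s => [|g s IH]; first by apply: filterS filterT => i _ h [].
  by apply: filterS (filterI (muP g) IH) => i [/= mug mus] h [<-|/mus].
have [i /= cobS] := filter_ex (muS S); apply: (theta_ncob i).
by exists (mu i); apply: (cocycle_coboundary_gen (chiP i) (thetaP i) genS).
Qed.

End Ultraproduct.

(** * Countability of G and compactness of E^1 *)

(** Words are coded as trees because trees over [nat] form a countable type; this is how a finitely
    generated group becomes countable. Ill-formed trees get the identity as default value. *)
Fixpoint word_eval (G : group) (S : seq G) (w : GenTree.tree nat) : G :=
  match w with
  | GenTree.Leaf n => nth (gone G) S n
  | GenTree.Node 0 [:: v; w] => gmul (word_eval S v) (word_eval S w)
  | GenTree.Node 1 [:: w] => ginv (word_eval S w)
  | _ => gone G
  end.

Lemma word_eval_surj (G : group) (S : seq G) g :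
  generated S g -> exists w, word_eval S w = g.
Proof.
elim=> {g} [g /(In_nth_ord (gone G))[i <-]||g h _ [v <-] _ [w <-]|g _ [w <-]].
- by exists (GenTree.Leaf (i : nat)).
- by exists (GenTree.Node 2 [::]).
- by exists (GenTree.Node 0 [:: v; w]).
- by exists (GenTree.Node 1 [:: w]).
Qed.

Definition trivial_on (G : group) (K : fieldType) (chi : G -> K) (L : seq G) :=
  forall g, List.In g L -> chi g = 1.

Definition fine_E1_character (G : group) (p : nat) (K : fieldType) (chi : G -> K) :=
  [/\ has_char K p, finite_trdeg K & in_E1 chi].

(** The last clause says that [L] generates the kernel of [chi] modulo commutators, as far as
    characters can see. Such a [chi] will serve as one of the final characters. *)
Definition E1_kernel_generators (G : group) (p : nat) (L : seq G) :=
  exists (K : fieldType) (chi : G -> K),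
    [/\ fine_E1_character p chi, trivial_on chi L
      & forall (K' : fieldType) (chi' : G -> K'), is_character chi' ->
          trivial_on chi' L -> forall g, chi g = 1 -> chi' g = 1].

Lemma E1_kernel_generators_exists (G : group) (p : nat) (K : fieldType) (chi : G -> K) :
  finitely_generated G -> has_char K p -> in_E1 chi ->
  exists2 L, E1_kernel_generators p L & trivial_on chi L.
Proof.
move=> Gfg Kp E1.
have [K' [chi' [K'p K'tr E1' chiE]]] := in_E1_finite_trdeg Gfg Kp E1.
have [L [L1 Lker]] := ker_character_fg Gfg E1'.1.
by exists L; [exists K', chi' | move=> g /L1 /chiE].
Qed.

Lemma E1_compactness (G : group) (p : nat) : finitely_generated G ->
  exists n (L : 'I_n -> seq G), (forall i, E1_kernel_generators p (L i)) /\
    forall (K : fieldType) (chi : G -> K), has_char K p -> in_E1 chi ->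
      exists i, trivial_on chi (L i).
Proof.
move=> Gfg; have [S genS] := Gfg.
have [w wK] := choice (fun g => word_eval_surj (genS g)).
(* [D] enumerates all finite lists in G by decoding numbers into lists of words. *)
pose D i : seq G := if unpickle i is Some l then map (word_eval S) l else [::].
have D_surj L : exists i, D i = L.
  by exists (pickle (map w L)); rewrite /D pickleK -map_comp (eq_map (g := id) wK) map_id.
pose good i := E1_kernel_generators p (D i).
suff [k kP] : exists k, forall (K : fieldType) (chi : G -> K),
    has_char K p -> in_E1 chi -> exists i, [/\ (i < k)%N, good i & trivial_on chi (D i)].
  (* Indices below [k] that are not good are redirected to a fixed good [i0]. If no index is good,
     E^1 is empty in characteristic [p] and the empty family works. *)
  have [[i0 good0]|no_good] := pselect (exists i, good i); last first.
    exists 0%N, (fun=> [::]); split=> [[]//|K chi Kp E1].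
    by have [i [_ gi _]] := kP K chi Kp E1; case: no_good; exists i.
  exists k, (fun i => D (if `[< good i >] then i : nat else i0)); split.
    by move=> i; case: ifP => // /asboolP.
  move=> K chi Kp E1; have [i [ik gi iP]] := kP K chi Kp E1.
  by exists (Ordinal ik); rewrite /= (asboolT gi).
apply/not_existsP => nk.
have {}nk k : exists C : {K : fieldType & G -> K}, [/\ has_char (projT1 C) p,
    in_E1 (projT2 C) & forall i, (i < k)%N -> good i -> ~ trivial_on (projT2 C) (D i)].
  have /existsNP[K /existsNP[chi]] := nk k; move=> /not_implyP[Kp /not_implyP[E1 no]].
  exists (existT _ K chi); split=> // i ik gi iP.
  by apply: no; exists i.
have [C CP] := choice nk.
(* Refining the filter of tails makes [U] nonprincipal: it contains every tail of [nat]. *)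
have [U [UF ooU]] := ultraFilterLemma eventually_filter.
pose K i := projT1 (C i).
pose chi g : ultraproduct K UF := ultra_class UF ((fun i => projT2 (C i) g) : seq_ring K).
have chiE1 : in_E1 chi by apply: ultraproduct_in_E1 => // i; have [] := CP i.
have Kp : has_char (ultraproduct K UF) p.
  by apply: ultraproduct_has_char => i; have [] := CP i.
have [L goodL LP] := E1_kernel_generators_exists Gfg Kp chiE1.
have [j jL] := D_surj L; rewrite -jL in goodL LP.
have LU L' : trivial_on chi L' -> U [set i | trivial_on (projT2 (C i)) L']%classic.
  elim: L' => [|g L' IH] L'P; first by apply: filterS filterT => i _ h [].
  have g1 : U [set i | projT2 (C i) g = 1]%classic.
    have := L'P g (or_introl erefl); rewrite -ultra_class1.
    by move/ultra_class_eq.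
  have L'1 : trivial_on chi L' by move=> h hL'; apply: L'P; right.
  by apply: filterS (filterI g1 (IH L'1)) => i [/= ig iL'] h [<-|/iL'].
(* An index [i] beyond [j] whose character is trivial on [D j] contradicts the choice of [C i]. *)
have jU : U [set i | (j < i)%N]%classic by apply: ooU; exists j.+1.
have [i [/= ji iP]] := filter_ex (filterI jU (LU _ LP)).
by have [_ _ /(_ j ji goodL)] := CP i.
Qed.

Theorem theorem8 (G : group) (p : nat) :
  finitely_generated G -> (prime p \/ p = 0%N) ->
  exists (n : nat) (Ks : 'I_n -> fieldType) (xi : forall i : 'I_n, G -> Ks i),
    (forall i : 'I_n, has_char (Ks i) p /\ finite_trdeg (Ks i) /\ in_E1 (xi i)) /\
    (forall (K : fieldType) (chi : G -> K), has_char K p -> in_E1 chi ->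
       exists i : 'I_n, forall g : G, xi i g = 1 -> chi g = 1).
Proof.
move=> Gfg _; have [n [L [LP cover]]] := E1_compactness p Gfg.
(* Field and character are chosen together as a dependent pair, since the type of the character
   depends on the field. *)
have [C CP] := choice (fun i => let: ex_intro K (ex_intro chi P) := LP i in
  ex_intro (fun C : {K : fieldType & G -> K} => [/\ fine_E1_character p (projT2 C),
    trivial_on (projT2 C) (L i) & forall (K' : fieldType) (chi' : G -> K'),
      is_character chi' -> trivial_on chi' (L i) ->
      forall g, projT2 C g = 1 -> chi' g = 1]) (existT _ K chi) P).
exists n, (fun i => projT1 (C i)), (fun i => projT2 (C i)); split.
  by move=> i; have [[]] := CP i.
move=> K chi Kp E1; have [i iP] := cover K chi Kp E1.
by exists i => g; have [_ _] := CP i; apply=> //; have [] := E1.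
Qed.
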